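(* For every integer $n \geq 1$, $d(Q_n) = 2^{n-1}$, where $Q_n$ is the $n$-hypercube, i.e. the Cartesian product of $n$ copies of the path $P_2$ on two vertices.
   Context: Graphs are finite and simple. The deduction game on a graph $G$: a layout is a placement of searchers on vertices of $G$ (a vertex may receive several searchers). A vertex is occupied in the layout if it contains at least one searcher, and unoccupied otherwise. A vertex is protected if it is occupied in the initial layout or if a searcher has moved there at some point, and unprotected otherwise. A vertex is fireable if the number of searchers on it is greater than or equal to the number of its unprotected neighbours. Initially every searcher is mobile; once a searcher has moved once, it becomes immobile (cannot move again). At each stage, simultaneously, for every fireable vertex $v$ containing mobile searchers, one searcher moves from $v$ to each unprotected neighbour of $v$ (excess searchers stay on $v$; several fireable vertices may send a searcher to the same target). Stages continue until no new searchers move. The layout is successful if at the end all vertices of $G$ are protected. The deduction number $d(G)$ is the minimum number of searchers in a successful layout on $G$. *)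

(* Defs.v *)
From mathcomp Require Import all_boot.

Set Implicit Arguments.
Unset Strict Implicit.
Unset Printing Implicit Defensive.

(* Finite simple graphs *)

Record sgraph := SGraph {
  vertex :> finType;
  adj : rel vertex;
  adj_sym : symmetric adj;
  adj_irr : irreflexive adj
}.

Definition path_rel (m : nat) : rel 'I_m :=
  fun i j => (i.+1 == j :> nat) || (j.+1 == i :> nat).

Lemma path_rel_sym m : symmetric (@path_rel m).
Proof. by move=> i j; rewrite /path_rel orbC. Qed.

Lemma path_rel_irr m : irreflexive (@path_rel m).
Proof. by move=> i; rewrite /path_rel orbb gtn_eqF. Qed.

Definition path_graph (m : nat) : sgraph :=
  SGraph (@path_rel_sym m) (@path_rel_irr m).

(* The n-fold Cartesian (box) product of G with itself: two n-tuples of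
   vertices are adjacent iff they are adjacent in one coordinate and agree in
   all the others. *)
Section CartesianPower.
Variables (G : sgraph) (n : nat).

Definition cart_rel : rel {ffun 'I_n -> G} := fun x y =>
  [exists i, adj (x i) (y i) && [forall (j | j != i), x j == y j]].

Lemma cart_rel_sym : symmetric cart_rel.
Proof.
move=> x y; apply: eq_existsb => i; rewrite adj_sym; congr (_ && _).
by apply: eq_forallb => j; rewrite [x j == _]eq_sym.
Qed.

Lemma cart_rel_irr : irreflexive cart_rel.
Proof. by move=> x; apply/existsP => -[i]; rewrite adj_irr. Qed.

Definition cart_power : sgraph := SGraph cart_rel_sym cart_rel_irr.

End CartesianPower.

Definition hypercube (n : nat) : sgraph := cart_power (path_graph 2) n.

(* The deduction game *)

Section DeductionGame.
Variable G : sgraph.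

(* Searchers are indistinguishable for the game, so a state only records how
   many mobile and immobile ones each vertex holds. *)
Record state := State {
  mobile : {ffun G -> nat};
  immobile : {ffun G -> nat};
  protected : {set G}
}.

(* A layout with d searchers sends each searcher to its starting vertex. *)
Definition layout (d : nat) := {ffun 'I_d -> G}.

Definition initial d (L : layout d) : state :=
  State [ffun v => #|[set i | L i == v]|] [ffun=> 0] [set L i | i : 'I_d].

Definition unprotected_nbrs (s : state) (v : G) : {set G} :=
  [set w | adj v w & w \notin protected s].

Definition fireable (s : state) (v : G) : bool :=
  #|unprotected_nbrs s v| <= mobile s v + immobile s v.

Definition fires (s : state) (v : G) : bool :=
  fireable s v && (0 < mobile s v).

(* The truncated subtraction is harmless by [fires_enough_mobile] below. *)
Definition stage (s : state) : state :=
  State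
    [ffun v => if fires s v then mobile s v - #|unprotected_nbrs s v|
               else mobile s v]
    [ffun w => immobile s w
               + #|[set v | fires s v & w \in unprotected_nbrs s v]|]
    (protected s :|: \bigcup_(v | fires s v) unprotected_nbrs s v).

Definition no_move (s : state) : bool :=
  [forall (v | fires s v), unprotected_nbrs s v == set0].

(* Every stage in which a searcher moves protects a new vertex, so #|G| stages
   suffice to reach the end of the game: see [final_no_move]. *)
Definition final d (L : layout d) : state := iter #|G| stage (initial L).

Definition successful d (L : layout d) : bool :=
  protected (final L) == [set: G].

Lemma fires_enough_mobile d (L : layout d) k (v : G) :
  let s := iter k stage (initial L) in
  fires s v -> #|unprotected_nbrs s v| <= mobile s v.
Proof.
move=> s; suff inv : (0 < mobile s v -> immobile s v = 0)
                  /\ (0 < mobile s v -> v \in protected s).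
  by case/andP => + m_gt0; rewrite /fireable inv.1 ?addn0.
rewrite {}/s; elim: k => [|k [IHi IHp]] /=.
  split; rewrite !ffunE // card_gt0 => /set0Pn[i]; rewrite inE => /eqP <-.
  exact: imset_f.
set s := iter k stage _ in IHi IHp *; rewrite !ffunE.
have mS : 0 < (if fires s v then mobile s v - #|unprotected_nbrs s v|
               else mobile s v) -> 0 < mobile s v.
  by case: ifP => // _ /leq_trans; apply; apply: leq_subr.
split=> /mS m_gt0; last by rewrite inE IHp.
rewrite IHi // add0n; apply/eqP; rewrite cards_eq0; apply/eqP/setP => u.
by rewrite !inE IHp // !andbF.
Qed.

Lemma no_move_stage s : no_move s -> stage s = s.
Proof.
move=> /forall_inP st; case: s st => m i p st; congr State.
- by apply/ffunP => v; rewrite ffunE; case: ifP => // /st/eqP->; rewrite cards0 subn0.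
- apply/ffunP => w; rewrite ffunE -[RHS]addn0; congr (_ + _).
  apply/eqP; rewrite cards_eq0; apply/eqP/setP => v; rewrite [LHS]inE [RHS]inE.
  by apply/negP => /andP[/st/eqP->]; rewrite inE.
- by rewrite big1 ?setU0 // => v /st/eqP.
Qed.

Lemma move_protects s : ~~ no_move s -> #|protected s| < #|protected (stage s)|.
Proof.
case/forall_inPn => v; rewrite -topredE /= => fv /set0Pn[w wv].
apply/proper_card/properP; split; first exact: subsetUl.
exists w; last by move: wv; rewrite inE => /andP[].
by rewrite inE; apply/orP; right; apply/bigcupP; exists v.
Qed.

Lemma final_no_move d (L : layout d) : no_move (final L).
Proof.
have step k : no_move (iter k stage (initial L))
           \/ k <= #|protected (iter k stage (initial L))|.
  elim: k => [|k IH]; first by right.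
  have [st|nst] := boolP (no_move (iter k stage (initial L))).
    by left; rewrite iterS (no_move_stage st).
  case: IH => [st|le_k]; first by rewrite st in nst.
  by right; apply: leq_ltn_trans le_k (move_protects nst).
case: (step #|G|) => // full; apply: contraT => nst.
by have := leq_trans (leq_ltn_trans full (move_protects nst)) (max_card _);
   rewrite ltnn.
Qed.

Definition has_successful_layout (d : nat) : bool :=
  [exists L : layout d, successful L].

Lemma successful_layout_exists : exists d, has_successful_layout d.
Proof.
exists #|G|; apply/existsP; exists [ffun i => enum_val i].
have mono k s : protected s \subset protected (iter k stage s).
  by elim: k => //= k IH; apply: subset_trans IH (subsetUl _ _).
rewrite /successful -subTset; apply: subset_trans (mono _ _).
apply/subsetP => v _; apply/imsetP; exists (enum_rank v) => //.
by rewrite ffunE enum_rankK.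
Qed.

Definition deduction_number : nat := ex_minn successful_layout_exists.

End DeductionGame.

(* Main.v *)
Require Import Defs.
From mathcomp Require Import all_boot.

Set Implicit Arguments.
Unset Strict Implicit.
Unset Printing Implicit Defensive.

(** Lower bound: in any graph, a searcher protects at most two vertices, the
one where it starts and the one to which it makes its only move.  A successful
layout of [d] searchers thus forces [#|G| <= 2 * d] ([successful_card]), that is
[2 ^ n <= 2 * d] for the hypercube.

Upper bound: put one searcher on each vertex of a facet [x i = 0].  The only
neighbour of such a vertex outside the facet is its reflection in direction
[i], so every vertex of the facet fires at once, and the opposite facet is
protected after a single stage ([one_stage_layout]).  Reflection exchanges the
two facets, so each of them has [2 ^ (n - 1)] vertices. *)

Section DeductionGameBounds.
Variable G : sgraph.
Implicit Types (s : state G) (A : {set G}).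

(** A stage spends one mobile searcher per pair of a firing vertex and an
unprotected neighbour, and newly protects at most one vertex per such pair, so
this potential cannot grow.  The hypothesis keeps the subtraction in [stage]
from truncating. *)
Lemma stage_potential s :
  (forall v, fires s v -> #|unprotected_nbrs s v| <= mobile s v) ->
  #|protected (stage s)| + \sum_v mobile (stage s) v
    <= #|protected s| + \sum_v mobile s v.
Proof.
move=> enough.
pose moves := \sum_(v | fires s v) #|unprotected_nbrs s v|.
have -> : \sum_v mobile s v = moves + \sum_v mobile (stage s) v.
  rewrite /moves [X in X + _]big_mkcond -big_split.
  apply: eq_bigr => v _ /=; rewrite ffunE.
  by case: ifP => // fv; rewrite subnKC // enough.
rewrite addnA leq_add2r; apply: leq_trans (leq_card_setU _ _) _.
rewrite leq_add2l /moves.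
apply: (big_ind2 (fun (B : {set G}) k => #|B| <= k)) => [|B k C l lek lel|//].
  by rewrite cards0.
exact: leq_trans (leq_card_setU B C) (leq_add lek lel).
Qed.

Lemma initial_potential d (L : layout G d) :
  #|protected (initial L)| + \sum_v mobile (initial L) v <= 2 * d.
Proof.
rewrite mul2n -addnn; apply: leq_add.
  by rewrite -[leqRHS]card_ord leq_imset_card.
rewrite -[leqRHS]card_ord -sum1_card (partition_big L predT) //=.
by apply: leq_sum => v _; rewrite ffunE sum1dep_card.
Qed.

Lemma successful_card d (L : layout G d) : successful L -> #|G| <= 2 * d.
Proof.
move=> /eqP full; apply: leq_trans (initial_potential L).
rewrite -cardsT -full /final; move: #|G| => k.
apply: leq_trans (leq_addr (\sum_v mobile (iter k (@stage G) (initial L)) v) _) _.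
elim: k => [|k IH]; first exact: leqnn.
by apply: leq_trans IH; apply: stage_potential => v; apply: fires_enough_mobile.
Qed.

Lemma protected_iter_stage k s : protected s \subset protected (iter k (@stage G) s).
Proof. by elim: k => //= k IH; apply: subset_trans IH (subsetUl _ _). Qed.

(** With one searcher on each vertex of [A], a vertex [v] of [A] has at most
the one unprotected neighbour [f v], so that all of [A] fires in the first
stage. *)
Lemma one_stage_layout A (f : G -> G) :
    (forall v w, v \in A -> w \notin A -> adj v w -> w = f v) ->
    (forall w, w \notin A -> exists2 v, v \in A & adj v w) ->
  has_successful_layout G #|A|.
Proof.
move=> uniqf dom; apply/existsP; pose L : layout G #|A| := [ffun i => enum_val i].
exists L.
have LA v : v \in A -> exists i, L i = v.
  by move=> vA; exists (enum_rank_in vA v); rewrite ffunE enum_rankK_in.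
have protA : protected (initial L) = A.
  apply/setP => v; apply/imsetP/idP => [[i _ ->]|/LA[i <-]]; last by exists i.
  by rewrite ffunE enum_valP.
have mobA v : v \in A -> 0 < mobile (initial L) v.
  by case/LA=> i Li; rewrite ffunE card_gt0; apply/set0Pn; exists i; rewrite inE Li.
have firesA v : v \in A -> fires (initial L) v.
  move=> vA; rewrite /fires mobA // andbT /fireable.
  apply: leq_trans (leq_addr _ _); apply: leq_trans (mobA v vA).
  rewrite -(cards1 (f v)); apply/subset_leq_card/subsetP => w.
  by rewrite !inE protA => /andP[vw wA]; apply/eqP/uniqf.
rewrite /successful -subTset; apply/subsetP => w _.
(* The vertex [w] itself shows that at least one stage is played. *)
have -> : final L = iter #|G|.-1 (@stage G) (stage (initial L)).
  by rewrite /final -iterSr prednK //; apply/card_gt0P; exists w.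
apply: (subsetP (protected_iter_stage _ _)); rewrite inE protA.
have [//|/= wA] := boolP (w \in A).
have [v vA vw] := dom w wA.
by apply/bigcupP; exists v; [exact: firesA | rewrite inE vw protA].
Qed.

(** The involution makes [A] and its complement equinumerous, so the lower bound
[#|G| / 2] meets the size of the one-stage layout on [A]. *)
Lemma deduction_number_matched_cut A (f : G -> G) :
    involutive f -> (forall v, adj v (f v)) ->
    (forall v, (f v \in A) = (v \notin A)) ->
    (forall v w, v \in A -> w \notin A -> adj v w -> w = f v) ->
  #|G| = 2 * #|A| /\ deduction_number G = #|A|.
Proof.
move=> fK adjf swapf uniqf.
have cardG : #|G| = 2 * #|A|.
  rewrite -(cardsC A) mul2n -addnn; congr (_ + _).
  rewrite -(card_preimset A (can_inj fK)); congr #|pred_of_set _|.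
  by apply/setP => v; rewrite !inE swapf.
split=> //; rewrite /deduction_number; case: ex_minnP => d /existsP[L succL] mind.
apply/eqP; rewrite eqn_leq mind /=.
  by rewrite -(leq_pmul2l (m := 2)) // -cardG (successful_card succL).
apply: (one_stage_layout uniqf) => w wA.
by exists (f w); [rewrite swapf | rewrite adj_sym].
Qed.

End DeductionGameBounds.

Lemma path_graph2_adj (a b : path_graph 2) : adj a b = (b == rev_ord a).
Proof. by case: a b => [[|[|a]] lta] [[|[|b]] ltb]. Qed.

Definition reflect_coord n (i : 'I_n) (x : hypercube n) : hypercube n :=
  [ffun j => if j == i then rev_ord (x j) else x j].

Lemma reflect_coordK n (i : 'I_n) : involutive (reflect_coord i).
Proof.
by move=> x; apply/ffunP => j; rewrite !ffunE; case: eqP => // _; rewrite rev_ordK.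
Qed.

Lemma hypercube_adjP n (x y : hypercube n) :
  reflect (exists i, y = reflect_coord i x) (adj x y).
Proof.
apply: (iffP existsP) => -[i].
  rewrite path_graph2_adj => /andP[/eqP yi /forall_inP same]; exists i.
  apply/ffunP => j; rewrite ffunE; case: eqVneq => [->|/same/eqP->] //.
move=> ->; exists i; rewrite path_graph2_adj ffunE !eqxx.
by apply/forall_inP => j /negPf ji; rewrite ffunE ji.
Qed.

Theorem corollary4p12 (n : nat) (n_ge1 : 1 <= n) :
  deduction_number (hypercube n) = 2 ^ (n - 1).
Proof.
pose i : 'I_n := Ordinal n_ge1.
pose A : {set hypercube n} := [set x : hypercube n | x i == ord0].
have swapA x : (reflect_coord i x \in A) = (x \notin A).
  by rewrite !inE ffunE eqxx; case: (x i) => [[|[|a]] lta].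
have uniqA x y : x \in A -> y \notin A -> adj x y -> y = reflect_coord i x.
  move=> xA yA /hypercube_adjP[j yE]; rewrite yE; congr reflect_coord.
  apply/eqP; apply: contraNT yA => /negPf ji.
  by rewrite inE yE ffunE [i == j]eq_sym ji; move: xA; rewrite inE.
have adjA x : adj x (reflect_coord i x) by apply/hypercube_adjP; exists i.
have [cardQ ->] := deduction_number_matched_cut (reflect_coordK i) adjA swapA uniqA.
apply/eqP; rewrite -(eqn_pmul2l (m := 2)) // -cardQ -expnS subn1 prednK //.
by rewrite card_ffun !card_ord.
Qed.
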